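(* Let $\beta\neq\frac{\pi}{2}$. If $S$ is a self-similar surface in $\mathbb{R}^3$ that is equiangular with characteristic angle $\beta$, then $S$ has a polar equation of the form $$\rho(\theta,\psi)=\rho_0e^{(\tan\beta)\psi}\qquad\text{or}\qquad \rho(\theta,\psi)=\rho_0e^{-(\tan\beta)\psi}$$ for some constant $\rho_0>0$.
   Context: Polar coordinates in $\mathbb{R}^3$: a surface $S$ has polar equation $\rho=\rho(\theta,\psi)$ if it is parametrized by $X(\theta,\psi)=(\rho\cos\psi\cos\theta,\ \rho\cos\psi\sin\theta,\ \rho\sin\psi)$, where $\rho=\rho(\theta,\psi)>0$ is a smooth function on an open connected nonempty set $D\subseteq\mathbb{R}^2$ of parameters; the angles $\theta$ and $\psi$ are allowed to range over all real numbers. A surface is self-similar if it has a polar equation of the form $\rho(\theta,\psi)=\rho_0e^{\mu\theta+b\psi}$ with constants $\rho_0>0$ and $\mu,b\in\mathbb{R}$; in addition, all planes and all cones are counted as self-similar surfaces. A smooth surface is equiangular if the angle $\beta$ between the normal vector $N$ and the radius (position) vector $X$ is the same at all points of the surface; $\beta$ is then called the characteristic angle of the surface. The sign of the normal may be chosen at each point so that $\beta\in[0,\frac{\pi}{2}]$; that is, the condition reads $|N\cdot X|=\cos\beta\,|N|\,|X|$ at every point where the normal is defined (for a surface given by a polar equation, $N=X_\theta\times X_\psi$ at points where this is nonzero; for a cone, the vertex is excluded). *)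

(* Defs.v *)
From HB Require Import structures.
From mathcomp Require Import all_boot all_order all_algebra.
From mathcomp Require Import all_classical all_reals all_analysis.

Set Implicit Arguments.
Unset Strict Implicit.
Unset Printing Implicit Defensive.

Import Order.TTheory GRing.Theory Num.Theory.
Import numFieldNormedType.Exports.

Local Open Scope classical_set_scope.
Local Open Scope ring_scope.

Section Vectors.
Context {R : realType}.

Definition vec3 (x y z : R) : 'rV[R]_3 := \row_i [:: x; y; z]`_i.

Definition dot (u v : 'rV[R]_3) : R := (u *m v^T) 0 0.

(* The library norm on row vectors is the sup norm. *)
Definition enorm (u : 'rV[R]_3) : R := Num.sqrt (dot u u).

Definition cross (u v : 'rV[R]_3) : 'rV[R]_3 :=
  let x (w : 'rV[R]_3) := w 0 0 in
  let y (w : 'rV[R]_3) := w 0 1 in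
  let z (w : 'rV[R]_3) := w 0 2%:R in
  vec3 (y u * z v - z u * y v) (z u * x v - x u * z v) (x u * y v - y u * x v).

End Vectors.

Section Smoothness.
Context {R : realType} {U V : normedModType R}.

(* On an open set of a finite-dimensional space (the only case used below)
   this is the usual C^k: all iterated directional derivatives up to order k
   exist and those of order k are continuous. *)
Fixpoint Ck_on (D : set U) (k : nat) (f : U -> V) : Prop :=
  if k is k'.+1 then
    (forall x v, D x -> derivable f x v) /\ (forall v, Ck_on D k' ('D_v f))
  else forall x, D x -> {for x, continuous f}.

Definition smooth_on (D : set U) (f : U -> V) : Prop :=
  forall k, Ck_on D k f.

End Smoothness.

(* Points where the parametrization fails to be an immersion are allowed:
   a polar equation can have such points where cos psi = 0, and the vertex of
   a cone is one. *)
Record surface (R : realType) := Surface {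
  dom : set (R * R);
  param : R * R -> 'rV[R]_3;
  dom_open : open dom;
  dom_connected : connected dom;
  dom_neq0 : dom !=set0;
  param_smooth : smooth_on dom param }.

Section Surfaces.
Context {R : realType}.

Definition normal (S : surface R) (p : R * R) : 'rV[R]_3 :=
  cross ('D_(1, 0) (param S) p) ('D_(0, 1) (param S) p).

Definition equiangular (beta : R) (S : surface R) : Prop :=
  0 <= beta <= pi / 2 /\
  forall p, dom S p -> normal S p != 0 ->
    `|dot (normal S p) (param S p)|
      = cos beta * enorm (normal S p) * enorm (param S p).

(* A pair p stands for (theta, psi). *)
Definition polar_map (rho : R * R -> R) (p : R * R) : 'rV[R]_3 :=
  let: (theta, psi) := p in
  vec3 (rho p * cos psi * cos theta) (rho p * cos psi * sin theta)
       (rho p * sin psi).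

Definition has_polar_equation (S : surface R) (rho : R * R -> R) : Prop :=
  [/\ smooth_on (dom S) rho,
      forall p, dom S p -> 0 < rho p &
      forall p, dom S p -> param S p = polar_map rho p].

Definition is_plane (S : surface R) : Prop :=
  exists q a b : 'rV[R]_3,
    [/\ free [:: a; b], dom S = setT &
        forall p, param S p = q + p.1 *: a + p.2 *: b].

(* Cones over arbitrary regular directrices w, with arbitrary vertex q, and
   with either both nappes (T = setT) or only one. The normal vanishes at the
   parameters p with p.2 = 0, so [equiangular] ignores the vertex. *)
Definition is_cone (S : surface R) : Prop :=
  exists (q : 'rV[R]_3) (w : R -> 'rV[R]_3) (J T : set R),
    [/\ smooth_on J w,
        forall s, J s -> free [:: w s; 'D_1 w s],
        T = setT \/ T = [set t | 0 < t],
        dom S = J `*` T &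
        forall p, dom S p -> param S p = q + p.2 *: w p.1].

Definition self_similar (S : surface R) : Prop :=
  [\/ exists rho0 mu b : R, 0 < rho0 /\
        has_polar_equation S (fun p => rho0 * expR (mu * p.1 + b * p.2)),
      is_plane S |
      is_cone S].

End Surfaces.

(* Main.v *)
Require Import Defs.
From mathcomp Require Import all_boot all_order all_algebra.
From mathcomp Require Import all_classical all_reals all_analysis.
From mathcomp Require Import ring lra.

Import Order.TTheory GRing.Theory Num.Theory.
Import numFieldNormedType.Exports.

Local Open Scope classical_set_scope.
Local Open Scope ring_scope.

(** Since beta lies in [0, pi/2[, k := cos beta ^+ 2 is positive, and squaring
    the angle condition gives the algebraic equation
    (N.X)^2 = k |N|^2 |X|^2 at every point, including those where N vanishes
    ([equiangular_squared]). The three kinds of self-similar surfaces are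
    then treated as follows.

    - On a plane or a cone there is a half-line q + t v, t > 0, with v != 0,
      along which the direction n of the normal is constant and orthogonal to
      v. Then N.X is n.q up to the scaling of n, so the equation forces
      |q + t v|^2 to be constant in t; it is a quadratic polynomial with
      leading coefficient |v|^2, a contradiction ([ray_not_equiangular]).

    - For rho = rho0 exp (mu theta + b psi), the moving frame (e_r, e_theta,
      e_psi) gives X_theta = rho (mu e_r + cos psi e_theta) and
      X_psi = rho (b e_r + e_psi). After division by rho^6 the equation reads
        cos^2 psi (1 - k (1 + b^2)) = k mu^2.
      It holds for all psi in an interval, where cos^2 is not constant
      ([cos2_not_locally_constant]); hence mu = 0 and 1 + b^2 = 1 / k, which is
      1 + tan^2 beta, so b is tan beta or its opposite. *)

(** * Vectors of Euclidean 3-space *)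

Lemma ord3_cases (j : 'I_3) : [\/ j = 0, j = 1 | j = 2%:R].
Proof.
case: j => -[|[|[|//]]] j3.
- by apply: Or31; exact: val_inj.
- by apply: Or32; exact: val_inj.
- by apply: Or33; exact: val_inj.
Qed.

Section Vectors.
Context {R : realType}.
Implicit Types u v : 'rV[R]_3.

Lemma dotE u v : dot u v = u 0 0 * v 0 0 + u 0 1 * v 0 1 + u 0 2%:R * v 0 2%:R.
Proof.
rewrite /dot !mxE !big_ord_recl big_ord0 !mxE addr0 addrA.
by congr (_ + u 0 _ * v 0 _ + u 0 _ * v 0 _); apply/val_inj.
Qed.

Lemma vec3_coord (x y z : R) :
  (vec3 x y z 0 0 = x) * (vec3 x y z 0 1 = y) * (vec3 x y z 0 2%:R = z).
Proof. by rewrite !mxE. Qed.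

Lemma row3_eq u v :
  u 0 0 = v 0 0 -> u 0 1 = v 0 1 -> u 0 2%:R = v 0 2%:R -> u = v.
Proof.
move=> e0 e1 e2; apply/rowP => j.
by case: (ord3_cases j) => ->.
Qed.

Lemma dot_ge0 u : 0 <= dot u u.
Proof. by rewrite dotE -!expr2 !addr_ge0 ?sqr_ge0. Qed.

Lemma dot_eq0 u : dot u u = 0 -> u = 0.
Proof.
rewrite dotE -!expr2 => h.
have h0 := sqr_ge0 (u 0 0); have h1 := sqr_ge0 (u 0 1).
have h2 := sqr_ge0 (u 0 2%:R).
apply: row3_eq; rewrite [RHS]mxE; apply/eqP; rewrite -sqrf_eq0; apply/eqP.
all: by lra.
Qed.

Lemma lagrange_identity u v :
  dot (cross u v) (cross u v) = dot u u * dot v v - dot u v ^+ 2.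
Proof. by rewrite !dotE /cross !vec3_coord; ring. Qed.

(** If u x v = 0 then |u|^2 |v|^2 = (u.v)^2, the equality case of
    Cauchy-Schwarz: the difference of u and its projection on v has squared
    norm (|u|^2 |v|^2 - (u.v)^2) / |v|^2 = 0. *)
Lemma cross_free u v : free [:: u; v] -> cross u v != 0.
Proof.
rewrite free_cons seq1_free => /andP[uv v0]; apply: contra uv => /eqP uv0.
have vv0 : dot v v != 0 by apply: contra v0 => /eqP/dot_eq0 ->.
have {}uv0 : dot u u * dot v v - dot u v ^+ 2 = 0.
  by rewrite -lagrange_identity uv0 dotE !mxE; ring.
rewrite span_seq1; apply/vlineP; exists (dot u v / dot v v).
apply/eqP; rewrite -subr_eq0; apply/eqP/dot_eq0.
transitivity ((dot u u * dot v v - dot u v ^+ 2) / dot v v).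
  by move: vv0; rewrite !dotE !mxE => vv0; field.
by rewrite uv0 mul0r.
Qed.

Lemma sqr_enorm u : enorm u ^+ 2 = dot u u.
Proof. by rewrite sqr_sqrtr // dot_ge0. Qed.

Lemma angle_squared (k : R) u v :
  `|dot u v| = k * enorm u * enorm v ->
  dot u v ^+ 2 = k ^+ 2 * dot u u * dot v v.
Proof. by move=> h; rewrite -real_normK ?num_real // h !exprMn !sqr_enorm. Qed.

(** As n.v = 0, the left-hand side is (n.q)^2 for all t, while the right-hand
    side is quadratic in t with leading coefficient k |n|^2 |v|^2 != 0. *)
Lemma ray_not_equiangular (k : R) (n q v : 'rV[R]_3) :
  k != 0 -> n != 0 -> v != 0 -> dot n v = 0 ->
  ~ forall t : R, 0 < t ->
      dot n (q + t *: v) ^+ 2 = k * dot n n * dot (q + t *: v) (q + t *: v).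
Proof.
move=> k0 n0 v0 nv0 h.
have e t : 0 < t -> dot n q ^+ 2 =
    k * dot n n * (dot q q + 2 * t * dot q v + t ^+ 2 * dot v v).
  move=> /h ht.
  transitivity ((dot n q + t * dot n v) ^+ 2); first by rewrite nv0; ring.
  transitivity (dot n (q + t *: v) ^+ 2); first by rewrite !dotE !mxE; ring.
  by rewrite ht !dotE !mxE; ring.
have : k * dot n n * dot v v = 0.
  (* e 1 - 2 * e 2 + e 3 is the second difference of the quadratic. *)
  have := e 1 ltac:(lra); have := e 2 ltac:(lra); have := e 3 ltac:(lra).
  by lra.
move/eqP; rewrite !mulf_eq0 (negPf k0) /= => /orP[] /eqP/dot_eq0/eqP.
  by rewrite (negPf n0).
by rewrite (negPf v0).
Qed.

End Vectors.

(** * Partial derivatives *)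

Section PartialDerivatives.
Context {R : realType}.

Lemma partial1E (V : normedModType R) (f : R * R -> V) p :
  'D_(1, 0) f p = 'D_1 (fun x => f (x, p.2)) p.1.
Proof.
rewrite /derive; apply: (congr1 (fun F : R -> V => lim (F @ 0^'))).
apply/funext => h /=.
case: p => x y /=.
rewrite (_ : h *: (1, 0) + (x, y) = (h%:A + x, y)) //.
by congr (_, _); rewrite /= scaler0 add0r.
Qed.

Lemma partial2E (V : normedModType R) (f : R * R -> V) p :
  'D_(0, 1) f p = 'D_1 (fun y => f (p.1, y)) p.2.
Proof.
rewrite /derive; apply: (congr1 (fun F : R -> V => lim (F @ 0^'))).
apply/funext => h /=.
case: p => x y /=.
rewrite (_ : h *: (0, 1) + (x, y) = (x, h%:A + y)) //.
by congr (_, _); rewrite /= scaler0 add0r.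
Qed.

Lemma derive_vec3 (f g h : R -> R) (x df dg dh : R) :
  is_derive x 1 f df -> is_derive x 1 g dg -> is_derive x 1 h dh ->
  'D_1 (fun t => vec3 (f t) (g t) (h t)) x = vec3 df dg dh.
Proof.
move=> [fd fE] [gd gE] [hd hE].
have e0 : (fun t => vec3 (f t) (g t) (h t) 0 0) = f.
  by apply/funext => t; rewrite vec3_coord.
have e1 : (fun t => vec3 (f t) (g t) (h t) 0 1) = g.
  by apply/funext => t; rewrite vec3_coord.
have e2 : (fun t => vec3 (f t) (g t) (h t) 0 2%:R) = h.
  by apply/funext => t; rewrite vec3_coord.
rewrite derive_mx.
  by apply: row3_eq; rewrite vec3_coord mxE ?e0 ?e1 ?e2.
apply/derivable_mxP => i j; rewrite (ord1 i) {i}.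
case: (ord3_cases j) => ->.
- rewrite e0.
  exact: fd.
- rewrite e1.
  exact: gd.
- rewrite e2.
  exact: hd.
Qed.

Lemma derive_affine (V : normedModType R) (a b : V) (x : R) :
  'D_1 (fun t : R => a + t *: b) x = b.
Proof.
apply: lim_near_cst => //; near=> h.
have h0 : h != 0 by near: h; exact: nbhs_dnbhs_neq.
rewrite /= opprD addrACA subrr add0r -scalerBl addrK.
by rewrite -[h%:A]/(h * 1) mulr1 scalerA mulVf // scale1r.
Unshelve. all: by end_near. Qed.

Lemma derive_homothety (V : normedModType R) (q : V) (t : R) (w : R -> V)
    (x : R) :
  derivable w x 1 -> 'D_1 (fun s => q + t *: w s) x = t *: 'D_1 w x.
Proof.
move=> wd; rewrite (@deriveD _ _ _ (cst q) (t \*: w)).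
- by rewrite derive_cst add0r deriveZ.
- exact: derivable_cst.
- exact: derivableZ.
Qed.

End PartialDerivatives.

(** * The normal of an exponential polar surface *)

Section PolarSurfaces.
Context {R : realType}.
Context (rho0 mu b : R).
Let rho (p : R * R) := rho0 * expR (mu * p.1 + b * p.2).

Lemma polar_partials (x y : R) (r := rho (x, y)) :
  ('D_(1, 0) (polar_map rho) (x, y) =
     vec3 (r * cos y * (mu * cos x - sin x)) (r * cos y * (mu * sin x + cos x))
       (r * mu * sin y)) *
  ('D_(0, 1) (polar_map rho) (x, y) =
     vec3 (r * (b * cos y - sin y) * cos x) (r * (b * cos y - sin y) * sin x)
       (r * (b * sin y + cos y))).
Proof.
rewrite partial1E partial2E /polar_map /rho /= -/r.
have ex : is_derive x 1 (fun t => rho0 * expR (mu * t + b * y)) (mu * r).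
  apply: trigger_derive; rewrite /r /rho /GRing.scale /=.
  ring.
have ey : is_derive y 1 (fun t => rho0 * expR (mu * x + b * t)) (b * r).
  apply: trigger_derive; rewrite /r /rho /GRing.scale /=.
  ring.
split; apply: derive_vec3; apply: trigger_derive.
all: by rewrite /GRing.scale /= /r /rho /=; ring.
Qed.

(** With u = X_theta and v = X_psi, |u x v|^2 = |u|^2 |v|^2 - (u.v)^2; in the
    orthonormal frame (e_r, e_theta, e_psi), u = r (mu e_r + cos y e_theta) and
    v = r (b e_r + e_psi), and X = r e_r. *)
Lemma polar_normal_dots (x y : R) (r := rho (x, y))
    (n := cross ('D_(1, 0) (polar_map rho) (x, y))
                ('D_(0, 1) (polar_map rho) (x, y))) :
  [/\ dot n n = r ^+ 4 * (cos y ^+ 2 * (1 + b ^+ 2) + mu ^+ 2),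
      dot n (polar_map rho (x, y)) = r ^+ 3 * cos y &
      dot (polar_map rho (x, y)) (polar_map rho (x, y)) = r ^+ 2].
Proof.
have hx := cos2Dsin2 x; have hy := cos2Dsin2 y.
rewrite {}/n !polar_partials /polar_map -/r; move: r hx hy => r.
set cx := cos x; set sx := sin x; set cy := cos y; set sy := sin y => hx hy.
set u := vec3 (r * cy * _) _ _; set v := vec3 (r * (_ - _) * _) _ _.
have uu : dot u u = r ^+ 2 * (cy ^+ 2 + mu ^+ 2).
  transitivity (r ^+ 2 * ((cx ^+ 2 + sx ^+ 2) * cy ^+ 2 * (mu ^+ 2 + 1)
    + mu ^+ 2 * sy ^+ 2)); first by rewrite dotE !vec3_coord; ring.
  rewrite hx mul1r.
  transitivity (r ^+ 2 * (cy ^+ 2 + mu ^+ 2 * (cy ^+ 2 + sy ^+ 2))).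
    by ring.
  by rewrite hy mulr1.
have vv : dot v v = r ^+ 2 * (1 + b ^+ 2).
  transitivity (r ^+ 2 * ((cx ^+ 2 + sx ^+ 2) * (b * cy - sy) ^+ 2
    + (b * sy + cy) ^+ 2)); first by rewrite dotE !vec3_coord; ring.
  rewrite hx mul1r.
  transitivity (r ^+ 2 * ((cy ^+ 2 + sy ^+ 2) * (1 + b ^+ 2))); first by ring.
  by rewrite hy mul1r.
have uv : dot u v = r ^+ 2 * (mu * b).
  transitivity (r ^+ 2 * mu * ((cx ^+ 2 + sx ^+ 2) * cy * (b * cy - sy)
    + sy * (b * sy + cy))); first by rewrite dotE !vec3_coord; ring.
  rewrite hx mul1r.
  transitivity (r ^+ 2 * mu * (b * (cy ^+ 2 + sy ^+ 2))); first by ring.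
  by rewrite hy; ring.
split; first by rewrite lagrange_identity uu vv uv; ring.
all: rewrite dotE /cross !vec3_coord.
- transitivity (r ^+ 3 * cy * (cx ^+ 2 + sx ^+ 2) * (cy ^+ 2 + sy ^+ 2)).
    by ring.
  by rewrite hx hy; ring.
- transitivity (r ^+ 2 * ((cx ^+ 2 + sx ^+ 2) * cy ^+ 2 + sy ^+ 2)).
    by ring.
  by rewrite hx mul1r hy mulr1.
Qed.

End PolarSurfaces.

(** * Equiangular surfaces *)

Section Equiangular.
Context {R : realType}.

(** The value of cos^2 * A at y, y + h and y - h is the same for a small h with
    sin h and cos h nonzero. The difference of the last two values gives
    cos y * sin y * A = 0 and their sum, compared with the first one, gives
    (cos^2 y - sin^2 y) * A = 0. So A = 0, because
    (c^2 - s^2)^2 + (2 c s)^2 = (c^2 + s^2)^2 = 1. *)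
Lemma cos2_not_locally_constant {A B y e : R} : 0 < e ->
  (forall t, `|y - t| < e -> cos t ^+ 2 * A = B) -> A = 0.
Proof.
move=> e0 AB; have pi0 := pi_gt0 R.
pose h := Num.min (e / 2) (pi / 4).
have h0 : 0 < h by rewrite lt_min !divr_gt0.
have he : h < e by rewrite gt_min ltr_pdivrMr ?ltr_pMr ?ltr1n ?e0.
have hpi : h < pi / 2 by rewrite gt_min; apply/orP; right; lra.
have sh : 0 < sin h by rewrite sin_gt0_pihalf // h0.
have ch : 0 < cos h by rewrite cos_gt0_pihalf // hpi andbT; lra.
have e1 := AB y ltac:(by rewrite subrr normr0).
have e2 := AB (y + h) ltac:(by rewrite opprD addNKr normrN gtr0_norm).
have e3 := AB (y - h) ltac:(by rewrite opprB addrC subrK gtr0_norm).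
move: e1 e2 e3; rewrite !cosD cosN sinN.
have hy := cos2Dsin2 y; have hh := cos2Dsin2 h.
move: hy hh sh ch; set c := cos y; set s := sin y.
set ch := cos h; set sh := sin h => hy hh sh0 ch0 e1 e2 e3.
have cs : c * s * A = 0.
  have : 4 * (ch * sh) * (c * s * A) = 0.
    transitivity ((c * ch - s * - sh) ^+ 2 * A - (c * ch - s * sh) ^+ 2 * A).
      by ring.
    by rewrite e2 e3 subrr.
  move/eqP; rewrite mulf_eq0 => /orP[|/eqP//].
  by rewrite !mulf_eq0 pnatr_eq0 !gt_eqF.
have cs2 : (c ^+ 2 - s ^+ 2) * A = 0.
  have : 2 * sh ^+ 2 * ((c ^+ 2 - s ^+ 2) * A) = 0.
    transitivity (2 * (c ^+ 2 * A) * (ch ^+ 2 + sh ^+ 2)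
        - (c * ch - s * - sh) ^+ 2 * A - (c * ch - s * sh) ^+ 2 * A).
      by ring.
    by rewrite e1 e2 e3 hh; ring.
  move/eqP; rewrite mulf_eq0 => /orP[|/eqP//].
  by rewrite mulf_eq0 pnatr_eq0 expf_eq0 !gt_eqF.
transitivity ((c ^+ 2 + s ^+ 2) ^+ 2 * A); first by rewrite hy; ring.
transitivity ((c ^+ 2 - s ^+ 2) * ((c ^+ 2 - s ^+ 2) * A)
  + 4 * (c * s) * (c * s * A)); first by ring.
by rewrite cs cs2 !mulr0 addr0.
Qed.

Context {beta : R} {S : surface R} (hang : equiangular beta S).

(** The angle condition is assumed only where the normal is nonzero; where it
    vanishes, so do both sides. *)
Lemma equiangular_squared {p} : dom S p ->
  dot (normal S p) (param S p) ^+ 2 =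
    cos beta ^+ 2 * dot (normal S p) (normal S p)
      * dot (param S p) (param S p).
Proof.
move=> Sp; have [n0|n0] := eqVneq (normal S p) 0.
  by rewrite n0 !dotE !mxE; ring.
exact/angle_squared/hang.2.
Qed.

Lemma normal_eq {f : R * R -> 'rV[R]_3} {p} : dom S p ->
  (forall p', dom S p' -> param S p' = f p') ->
  normal S p = cross ('D_(1, 0) f p) ('D_(0, 1) f p).
Proof.
move=> Sp Sf; rewrite /normal.
have nf : \near p, param S p = f p.
  by apply: filterS Sf _; exact: open_nbhs_nbhs (conj (@dom_open _ S) Sp).
by rewrite !(near_eq_derive _ nf).
Qed.

(** At fixed x, the angle condition is an affine relation in cos^2 t, valid for
    t in an interval; both its coefficients vanish. *)
Lemma equiangular_exponential_polar {rho0 mu b : R} : 0 < rho0 ->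
  has_polar_equation S (fun p => rho0 * expR (mu * p.1 + b * p.2)) ->
  cos beta != 0 -> mu = 0 /\ b ^+ 2 = tan beta ^+ 2.
Proof.
move=> r0 [_ _ Srho] k0; have [[x y] Sxy] := @dom_neq0 _ S.
have [e e0 Se] : exists2 e, 0 < e & forall t, `|y - t| < e -> dom S (x, t).
  have /nbhs_ballP[e /= e0 eS] : nbhs (x, y) (dom S).
    exact: open_nbhs_nbhs (conj (@dom_open _ S) Sxy).
  by exists e => // t yt; apply: eS; split => //=; exact: ballxx.
set k := cos beta ^+ 2.
have key t : `|y - t| < e ->
    cos t ^+ 2 * (1 - k * (1 + b ^+ 2)) = k * mu ^+ 2.
  move=> /Se St; have := equiangular_squared St.
  rewrite (normal_eq St Srho) Srho //.
  have [-> -> ->] := polar_normal_dots rho0 mu b x t.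
  set r := rho0 * _; rewrite -/k => h.
  have r6 : r ^+ 6 != 0 by rewrite expf_neq0 // mulf_neq0 ?gt_eqF ?expR_gt0.
  by apply: (mulfI r6); move: h; rewrite exprMn => h; lra.
have A0 := cos2_not_locally_constant e0 key.
have kb : k * (1 + b ^+ 2) = 1 by lra.
have kmu : k * mu ^+ 2 = 0.
  by rewrite -(key y) ?subrr ?normr0 // A0 mulr0.
split.
  by move/eqP: kmu; rewrite mulf_eq0 /k !expf_eq0 /= (negPf k0) /= => /eqP.
have kn0 : k != 0 by rewrite expf_neq0.
apply: (addrI 1); rewrite -cos2_tan2 // -/k.
by apply: (mulfI kn0); rewrite kb divff.
Qed.

(** The direction b gives the half-line q + t b in the plane. *)
Lemma plane_not_equiangular : cos beta != 0 -> ~ is_plane S.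
Proof.
move=> k0 [q [a [b [ab ST Sab]]]].
have nE p : normal S p = cross a b.
  rewrite (@normal_eq (fun p => q + p.1 *: a + p.2 *: b)) ?ST //.
  rewrite partial1E partial2E /= derive_affine.
  by under eq_fun do rewrite addrAC; rewrite derive_affine.
have b0 : b != 0 by move: ab; rewrite free_cons seq1_free => /andP[].
apply: (@ray_not_equiangular _ (cos beta ^+ 2) (cross a b) q b) => //.
- by rewrite expf_neq0.
- exact: cross_free.
- by rewrite dotE /cross !vec3_coord; ring.
move=> t _; have := @equiangular_squared (0, t); rewrite ST nE Sab /=.
by rewrite scale0r addr0; apply.
Qed.

(** A generating half-line q + t w(x) works: along it the normal is
    - t (w(x) x w'(x)), of constant direction. *)
Lemma cone_not_equiangular : cos beta != 0 -> ~ is_cone S.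
Proof.
move=> k0 [q [w [J [T [wJ wf TT ST Sw]]]]].
have T0 t : 0 < t -> T t by case: TT => ->.
have [[x y]] := @dom_neq0 _ S; rewrite ST => -[/= Jx _].
have St t : 0 < t -> dom S (x, t) by move=> /T0 Tt; rewrite ST.
have wd : derivable w x 1 by apply: (wJ 1%N).1.
have nE t : 0 < t -> normal S (x, t) = - t *: cross (w x) ('D_1 w x).
  move=> /St Sxt; rewrite (normal_eq Sxt Sw) partial1E partial2E /=.
  rewrite derive_affine derive_homothety //.
  by apply: row3_eq; rewrite [RHS]mxE /cross !vec3_coord !mxE; ring.
have w0 : w x != 0.
  by have := wf _ Jx; apply: contraTneq => ->; rewrite free_cons mem0v.
apply: (@ray_not_equiangular _ (cos beta ^+ 2) (cross (w x) ('D_1 w x)) q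
  (w x)).
- by rewrite expf_neq0.
- exact/cross_free/wf.
- by [].
- by rewrite dotE /cross !vec3_coord; ring.
move=> t t0; have := equiangular_squared (St t t0).
rewrite (nE t t0) (Sw (x, t)) /=; last exact: St.
set n := cross _ _; set X := q + _ => h.
have t2 : t ^+ 2 != 0 by rewrite expf_neq0 ?gt_eqF.
apply: (mulfI t2).
transitivity (dot (- t *: n) X ^+ 2); first by rewrite !dotE !mxE; ring.
by rewrite h !dotE !mxE; ring.
Qed.

End Equiangular.

Theorem mainTheorem2 (R : realType) (beta : R) (S : surface R)
    (hbeta : beta != pi / 2) (hsim : self_similar S)
    (hang : equiangular beta S) :
  exists rho0 : R, 0 < rho0 /\
    (has_polar_equation S (fun p => rho0 * expR (tan beta * p.2)) \/
     has_polar_equation S (fun p => rho0 * expR (- tan beta * p.2))).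
Proof.
have k0 : cos beta != 0.
  have /andP[b0 b1] := hang.1.
  have bpi : beta < pi / 2 by rewrite lt_neqAle hbeta.
  rewrite gt_eqF // cos_gt0_pihalf // bpi andbT (lt_le_trans _ b0) //.
  by rewrite oppr_lt0 divr_gt0 ?pi_gt0.
case: hsim => [[rho0 [mu [b [r0 Srho]]]]|/(plane_not_equiangular hang k0)//|
  /(cone_not_equiangular hang k0)//].
have [mu0 /eqP] := equiangular_exponential_polar hang r0 Srho k0.
have {}Srho : has_polar_equation S (fun p => rho0 * expR (b * p.2)).
  move: Srho; congr (has_polar_equation S _); apply/funext => p.
  by rewrite mu0 mul0r add0r.
rewrite eqf_sqr => /orP[] /eqP bE; exists rho0; split => //; [left|right];
  by rewrite -bE.
Qed.
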